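(* Let $d>2$ be an integer, let $\alpha$ be a Pisot number and $\lambda=\alpha^{-1}$. Let $\mu_\lambda$ be the Hutchinson measure on $\mathbb{R}^d$ of the IFS $\{\tau_b(x)=\lambda(x+b)\}_{b\in B_d}$ with $B_d=\{\mathbf 0,\mathbf e_1,\dots,\mathbf e_d\}$ and equal weights $\frac1{d+1}$. Then $\mu_\lambda$ is not absolutely continuous with respect to Lebesgue measure; $\mu_\lambda$ is purely continuous and singular.
   Context: A Pisot number is an algebraic integer $\alpha>1$ (real) all of whose Galois conjugates other than $\alpha$ itself have modulus less than $1$. $\mathbf e_i$ is the $i$th standard basis vector of $\mathbb{R}^d$. The Hutchinson measure of the contractive affine IFS $\{\tau_b\}_{b\in B_d}$ with equal weights is the unique Borel probability measure $\mu$ on $\mathbb{R}^d$ satisfying $\mu=\frac{1}{d+1}\sum_{b\in B_d}\mu\circ\tau_b^{-1}$. A measure is purely continuous and singular if its absolutely continuous part (with respect to Lebesgue measure) and its atomic part are both zero. *)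

(* Defs.v *)
From HB Require Import structures.
From mathcomp Require Import all_boot all_order all_algebra.
From mathcomp Require Import complex.
From mathcomp Require Import all_classical all_reals all_analysis.
From mathcomp Require Import measurable_realfun.

Set Implicit Arguments.
Unset Strict Implicit.
Unset Printing Implicit Defensive.

Import Order.TTheory GRing.Theory Num.Theory.
Import numFieldNormedType.Exports.

Local Open Scope classical_set_scope.
Local Open Scope ring_scope.

Section pisot.
Variable R : realType.

(* z is a complex root of the minimal polynomial of a over the rationals. *)
Definition galois_conjugate (a : R) (z : R[i]) : Prop :=
  exists p : {poly rat},
    [/\ irreducible_poly p, root (map_poly ratr p) a
      & root (map_poly ratr p) z].

Definition is_pisot (a : R) : Prop :=
  [/\ 1 < a, integralOver (intr : int -> R) a
    & forall z : R[i], galois_conjugate a z -> z <> (a%:C)%C -> `|z| < 1].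

End pisot.

(* The Borel sigma-algebra of R^n; the topology of matrices is the product
   topology. *)
HB.instance Definition _ (R : realType) (n : nat) :=
  @isMeasurable.Build (sigma_display (@open 'rV[R]_n)) 'rV[R]_n
    <<s @open 'rV[R]_n >> (@sigma_algebra0 _ setT _) (@sigma_algebraC _ _)
    (@sigma_algebra_bigcup _ setT _).

Section borel_rV.
Variable R : realType.

Lemma measurable_rV_coord n (i : 'I_n) :
  measurable_fun [set: 'rV[R]_n] (fun x => x 0 i : measurableTypeR R).
Proof.
apply: (@measurability _ _ _ _ _ _ (@RGenOpens.G R)).
  exact: RGenOpens.measurableE.
move=> _ [_ [a [b ->]] <-]; rewrite setTI; apply: sub_sigma_algebra.
by apply: open_comp (@interval_open _ _ _ _ _) => // x _; exact: coord_continuous.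
Qed.

Let rat_ball n (qk : 'rV[rat]_n * nat) : set 'rV[R]_n :=
  ball (map_mx ratr qk.1 : 'rV[R]_n) (qk.2.+1%:R^-1 : R).

Lemma open_rV_bigcup n (U : set 'rV[R]_n) : open U ->
  U = \bigcup_(qk in [set qk | @rat_ball n qk `<=` U]) rat_ball qk.
Proof.
move=> oU; apply/seteqP; split=> [x Ux|x [qk /= qkU xqk]]; last exact: qkU.
have : nbhs x U by exact: open_nbhs_nbhs.
rewrite -nbhs_ballE => -[e /= e0 xeU].
pose k := Num.trunc (2 / e).
have k0 : 0 < (k.+1%:R^-1 : R) by rewrite invr_gt0.
have ke : k.+1%:R^-1 < e / 2 :> R.
  rewrite -[e / 2]invrK invf_div ltf_pV2 ?posrE ?divr_gt0//.
  exact: truncnS_gt.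
have qP i : {q : rat | x 0 i - k.+1%:R^-1 < ratr q < x 0 i + k.+1%:R^-1}.
  apply: cid; have /rat_in_itvoo[q] : x 0 i - k.+1%:R^-1 < x 0 i + k.+1%:R^-1.
    by rewrite ltrBlDr -addrA ltrDl addr_gt0.
  by rewrite in_itv/= => qx; exists q.
pose q : 'rV[rat]_n := \row_i sval (qP i).
have bqx : rat_ball (q, k) x.
  split=> [//|i j]; rewrite !mxE ord1 -ball_normE/= ltr_distl.
  exact: svalP (qP j).
exists (q, k) => //= y bqy; apply: xeU.
apply: (le_ball _ (ball_triangle (ball_sym bqx) bqy)).
by rewrite ltW// (splitr e) ltrD.
Qed.

Lemma measurable_fun_rV d (T : measurableType d) n (f : T -> 'rV[R]_n) :
  (forall i, measurable_fun [set: T] (fun t => f t 0 i : measurableTypeR R)) ->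
  measurable_fun [set: T] f.
Proof.
move=> mf; apply: (@measurability _ _ _ _ _ _ (@open 'rV[R]_n)) => //.
move=> _ [U oU <-]; rewrite setTI (open_rV_bigcup oU) bigcup_mkcond.
rewrite preimage_bigcup; apply: countable_bigcupT_measurable => // -[q k].
case: ifPn => _; last by rewrite preimage_set0.
rewrite [X in measurable X](_ : _ = \bigcap_(i in [set: 'I_n])
    ((fun t => f t 0 i) @^-1` ball (ratr (q 0 i) : R) (k.+1%:R^-1 : R))); last first.
  apply/seteqP; split=> [t /= [_ ft] i _|t /= ft].
    by have := ft 0 i; rewrite !mxE.
  by split=> [|i j]; rewrite ?invr_gt0// ord1 !mxE; exact: ft.
apply: fin_bigcap_measurable => // i _.
by rewrite -[X in measurable X]setTI; apply: mf => //; exact: measurable_ball.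
Qed.

Definition rV_cons n (u : measurableTypeR R * 'rV[R]_n) : 'rV[R]_n.+1 :=
  \row_i (if unlift ord0 i is Some j then u.2 0 j else u.1).

Lemma measurable_rV_cons n : measurable_fun setT (@rV_cons n).
Proof.
apply: measurable_fun_rV => i.
under eq_fun do rewrite mxE.
case: (unlift ord0 i) => [j|]; last exact: measurable_fst.
exact: (measurableT_comp (measurable_rV_coord j) measurable_snd).
Qed.

Definition rV_uncons n (x : 'rV[R]_n.+1) : measurableTypeR R * 'rV[R]_n :=
  (x 0 ord0, \row_j x 0 (lift ord0 j)).

Lemma measurable_rV_uncons n : measurable_fun setT (@rV_uncons n).
Proof.
apply/measurable_fun_pair; first exact: measurable_rV_coord.
apply: measurable_fun_rV => i.
under eq_fun do rewrite mxE.
exact: measurable_rV_coord.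
Qed.

Lemma rV_consK n : cancel (@rV_cons n) (@rV_uncons n).
Proof.
case=> a x; rewrite /rV_uncons/= mxE unlift_none; congr pair.
by apply/rowP => j; rewrite !mxE liftK.
Qed.

Section step.
Local Open Scope ereal_scope.
Variables (n : nat) (L : {sigma_finite_measure set 'rV[R]_n -> \bar R}).

Definition lebesgue_rV_step : set 'rV[R]_n.+1 -> \bar R :=
  pushforward (@lebesgue_measure R \x L) (@rV_cons n).

Let step0 : lebesgue_rV_step set0 = 0.
Proof. by rewrite /lebesgue_rV_step /pushforward preimage_set0 measure0. Qed.

Let step_ge0 A : 0 <= lebesgue_rV_step A.
Proof. by rewrite /lebesgue_rV_step /pushforward measure_ge0. Qed.

Let step_sigma_additive : semi_sigma_additive lebesgue_rV_step.
Proof.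
by apply: measure_semi_sigma_additive; exact: measurable_rV_cons.
Qed.

HB.instance Definition _ := isMeasure.Build _ _ _ lebesgue_rV_step
  step0 step_ge0 step_sigma_additive.

Let step_sigma_finite : sigma_finite setT lebesgue_rV_step.
Proof.
have /sigma_finiteP[F [TF ndF Foo]] := sigma_finiteT (@lebesgue_measure R).
have /sigma_finiteP[G [TG ndG Goo]] := sigma_finiteT L.
exists (fun k => @rV_uncons n @^-1` (F k `*` G k)).
  rewrite -preimage_bigcup (_ : \bigcup_k _ = setT) ?preimage_setT//.
  apply/seteqP; split=> // -[a x] _.
  have [i _ Fia] : (\bigcup_i F i) a by rewrite -TF.
  have [j _ Gjx] : (\bigcup_j G j) x by rewrite -TG.
  exists (maxn i j) => //; split => /=.
  - by move: a Fia; exact/subsetPset/ndF/leq_maxl.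
  - by move: x Gjx; exact/subsetPset/ndG/leq_maxr.
move=> k; have [mF Fk] := Foo k; have [mG Gk] := Goo k; split.
  rewrite -[X in measurable X]setTI; apply: measurable_rV_uncons => //.
  exact: measurableX.
rewrite /lebesgue_rV_step /pushforward -comp_preimage.
rewrite (_ : _ \o _ = id); last by apply/funext => u /=; rewrite rV_consK.
by rewrite preimage_id product_measure1E// lte_mul_pinfty// ge0_fin_numE.
Qed.

HB.instance Definition _ := Measure_isSigmaFinite.Build _ _ _ lebesgue_rV_step
  step_sigma_finite.

End step.

Fixpoint lebesgue_rV n : {sigma_finite_measure set 'rV[R]_n -> \bar R} :=
  if n is n'.+1 then lebesgue_rV_step (lebesgue_rV n') else \d_(0 : 'rV[R]_0).

Lemma lebesgue_rV_box n (A : 'I_n -> set (measurableTypeR R)) :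
  (forall i, measurable (A i)) ->
  lebesgue_rV n [set x | forall i, A i (x 0 i)] =
  (\prod_(i < n) lebesgue_measure (A i))%E.
Proof.
elim: n A => [|n IHn] A mA.
  by rewrite big_ord0 /= diracE mem_set//= => -[].
rewrite big_ord_recl -IHn// -product_measure1E//; last first.
  rewrite [X in measurable X](_ : _ = \bigcap_(i in [set: 'I_n])
    ((fun x : 'rV[R]_n => x 0 i) @^-1` A (lift ord0 i))); last first.
    by apply/seteqP; split=> [x /= Ax i _|x /= Ax i]; exact: Ax.
  apply: fin_bigcap_measurable => // i _.
  by rewrite -[X in measurable X]setTI; exact: measurable_rV_coord.
rewrite /= /lebesgue_rV_step /pushforward; congr product_measure1.
apply/seteqP; split=> -[a x] /=.
  move=> Aax; split=> [|i] /=.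
    by have := Aax ord0; rewrite mxE unlift_none.
  by have := Aax (lift ord0 i); rewrite mxE liftK.
move=> [/= Aa Ax] i; rewrite mxE.
by case: unliftP => [j|] ->.
Qed.

End borel_rV.

Section singular_continuous.
Local Open Scope ereal_scope.
Context d (T : measurableType d) (R : realType).
Implicit Types (leb mu ac sg : {measure set T -> \bar R}).

Definition mutually_singular mu leb : Prop :=
  exists N : set T, [/\ measurable N, leb N = 0 & mu (~` N) = 0].

(* ac is the absolutely continuous part of the Lebesgue decomposition
   mu = ac + sg of mu with respect to leb. *)
Definition is_ac_part leb mu ac : Prop :=
  exists sg, [/\ ac `<< leb, mutually_singular sg leb
    & forall A, measurable A -> mu A = ac A + sg A].

Definition atomic_part mu (A : set T) : \bar R :=
  \esum_(x in A) mu [set x].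

(* The first clause excludes a vacuous second one; as the Lebesgue
   decomposition is unique, the two together say that the absolutely
   continuous part exists and is zero. *)
Definition purely_singular_continuous leb mu : Prop :=
  [/\ exists ac, is_ac_part leb mu ac,
      forall ac, is_ac_part leb mu ac -> forall A, measurable A -> ac A = 0
    & forall A, measurable A -> atomic_part mu A = 0].

End singular_continuous.

Section simplex_ifs.
Variables (R : realType) (n : nat).

Definition simplex_digits : seq 'rV[R]_n :=
  0 :: [seq delta_mx 0 i | i <- enum 'I_n].

Definition ifs_map (lambda : R) (b x : 'rV[R]_n) : 'rV[R]_n :=
  lambda *: (x + b).

Definition is_hutchinson (lambda : R) (mu : probability 'rV[R]_n R) : Prop :=
  forall A : set 'rV[R]_n, measurable A ->
    mu A = ((n.+1%:R^-1)%:E *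
      \sum_(b <- simplex_digits) mu (ifs_map lambda b @^-1` A))%E.

End simplex_ifs.

(* Main.v *)
(* Projecting mu to one coordinate gives a probability nu on the line with
   nu = q nu o t0^-1 + p nu o t1^-1, where t0 x = x / alpha, t1 x = (x + 1) / alpha,
   p = 1 / (d + 1) and q = d / (d + 1); it suffices to show that nu is singular
   and atomless.  Removing from nu a Lebesgue-null set of maximal nu-measure
   leaves an absolutely continuous measure rho with the same self-similarity,
   and its Fourier transform satisfies
     |rho^(alpha xi)|^2 = (1 - 2 p q (1 - cos xi)) |rho^(xi)|^2,
   where the factor is positive because p <> q.  For some m > 0,
   m alpha^j is exponentially close to an integer, namely the sum of the j-th
   powers of the roots of the minimal polynomial of alpha, so along xi = 2 pi m alpha^j these factors have a
   positive product, whereas |rho^|^2 tends to 0 there by the Riemann-Lebesgue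
   lemma.  Hence rho^ vanishes at 2 pi m alpha^j for all integers j, and j -> -oo
   gives rho = 0. *)
Require Import Defs.
From HB Require Import structures.
From mathcomp Require Import all_boot all_order all_algebra.
From mathcomp Require Import complex.
From mathcomp Require Import all_classical all_reals all_analysis.
From mathcomp Require Import measurable_realfun.
From mathcomp Require Import ring lra zify.

Set Implicit Arguments.
Unset Strict Implicit.
Unset Printing Implicit Defensive.

Import Order.TTheory GRing.Theory Num.Theory.
Import numFieldNormedType.Exports.

Local Open Scope classical_set_scope.
Local Open Scope ring_scope.

(** * Powers of Pisot numbers *)

Section pisot_integers.

Lemma algebraic_integer_minpoly (F : numFieldType) (a : F) :
  integralOver (intr : int -> F) a ->
  exists p : {poly int}, [/\ p \is monic,
    irreducible_poly (map_poly intr p : {poly rat})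
    & root (map_poly intr p) a].
Proof.
move=> [P monP Pa].
have PZQ (p : {poly int}) :
    map_poly ratr (map_poly intr p : {poly rat}) = map_poly intr p :> {poly F}.
  by rewrite -map_poly_comp; apply: eq_map_poly => z /=; rewrite ratr_int.
pose Q n := `[< exists p : {poly rat},
  [/\ p != 0, size p = n & root (map_poly ratr p) a] >].
have exQ : exists n, Q n.
  exists (size P); apply/asboolP; exists (map_poly intr P); split.
  - by rewrite monic_neq0 ?monic_map.
  - by rewrite size_rat_int_poly.
  - by rewrite PZQ.
case: (ex_minnP exQ) => n /asboolP[p [p0 szp pa]] minp.
have size_gt1 (q : {poly rat}) : q != 0 -> root (map_poly ratr q) a ->
    (1 < size q)%N.
  move=> q0 qa; rewrite ltnNge; apply/negP => /size1_polyC qE.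
  move: qa q0; rewrite qE map_polyC rootC /= fmorph_eq0 => /eqP ->.
  by rewrite polyC0 eqxx.
have irrp : irreducible_poly p.
  split=> [|q q1 qp]; first exact: size_gt1.
  have [r pE] := dvdpP _ _ qp.
  have [r0 q0] : r != 0 /\ q != 0 by apply/andP; rewrite -negb_or -mulf_eq0 -pE.
  (* Whichever factor vanishes at [a] has at least the size of [p]; for [r] this would leave [q]
     constant. *)
  have : root (map_poly ratr (r * q)) a by rewrite -pE.
  rewrite rmorphM rootM => /orP[ra|qa].
  - have := minp _ (introT (asboolP _) (ex_intro _ r (And3 r0 erefl ra))).
    rewrite -szp pE size_mul // => szr.
    have arith (x y : nat) : (0 < y -> y != 1 -> (x + y).-1 <= x -> False)%N by lia.
    by case: (arith _ _ _ q1 szr); rewrite size_poly_gt0.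
  - have := minp _ (introT (asboolP _) (ex_intro _ q (And3 q0 erefl qa))).
    rewrite -szp => sqp; rewrite -(dvdp_size_eqp qp) eqn_leq sqp andbT.
    exact: dvdp_leq.
have dvdP : p %| map_poly intr P.
  rewrite /dvdp; apply: contraT => r0.
  have ra : root (map_poly ratr (map_poly intr P %% p)) a.
    move: Pa; rewrite -PZQ {1}(divp_eq (map_poly intr P) p) rmorphD rmorphM /=.
    by rewrite rootE hornerD hornerM (rootP pa) mulr0 add0r.
  have := minp _ (introT (asboolP _) (ex_intro _ _ (And3 r0 erefl ra))).
  by rewrite -szp leqNgt ltn_modp p0.
have [p1 [c c0 pE] [r PE]] := dvdpP_rat_int dvdP.
(* The leading coefficient divides 1, so it is 1 or -1, and multiplying by it makes [p1] monic. *)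
have lu : lead_coef p1 * lead_coef p1 = 1.
  have /eqP : lead_coef p1 * lead_coef r = 1.
    by rewrite -lead_coefM -PE (monicP monP).
  by rewrite mulrC => /eqP /intUnitRing.unitzPl /pred2P[] ->; rewrite ?mulrNN mulr1.
have l0 : lead_coef p1 != 0 by apply/eqP => e; move: lu; rewrite e mul0r.
exists (lead_coef p1 *: p1); split.
- by rewrite monicE lead_coefZ lu.
- have eqpp : map_poly intr (lead_coef p1 *: p1) %= p.
    rewrite map_polyZ pE eqp_sym; apply: (eqp_trans (eqp_scale _ c0)).
    by rewrite eqp_sym eqp_scale // intr_eq0.
  split=> [|q q1 qp]; first by rewrite (eqp_size eqpp) irrp.1.
  apply: eqp_trans (_ : q %= p) _; last by rewrite eqp_sym.
  by apply: irrp.2 => //; rewrite -(eqp_dvdr _ eqpp).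
- move: pa; rewrite pE map_polyZ PZQ rootZ ?fmorph_eq0 // => pa.
  by rewrite map_polyZ rootZ // intr_eq0.
Qed.

(** Product rule in terms of exact quotients: this is the case [j = 0] of the polynomials [Q j] used
    for the power sums below. *)
Lemma deriv_prod_XsubC (F : fieldType) (rs : seq F) :
  (\prod_(z <- rs) ('X - z%:P))^`() =
  \sum_(z <- rs) (\prod_(y <- rs) ('X - y%:P)) %/ ('X - z%:P).
Proof.
elim: rs => [|z rs IH]; first by rewrite !big_nil derivC.
rewrite !big_cons derivM derivXsubC mul1r mulKp ?polyXsubC_eq0 //.
rewrite {}IH mulr_sumr; congr (_ + _); apply: eq_big_seq => y yrs.
by rewrite divp_mulA // dvdp_XsubCl root_prod_XsubC.
Qed.

(** Each quotient P / (X - z) is monic of degree [(size rs).-1], so the power sum is the coefficient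
    of that degree in [Q j]. The [Q j] have integer coefficients by induction: [Q 0] is the
    derivative of P, and Q (j + 1) = X Q j - s_j P with s_j the [j]-th power sum. *)
Lemma power_sum_int (F : fieldType) (p : {poly int}) (rs : seq F) :
  p \is monic -> map_poly intr p = \prod_(z <- rs) ('X - z%:P) ->
  forall j, exists N : int, \sum_(z <- rs) z ^+ j = N%:~R.
Proof.
set P := \prod_(z <- rs) _ => monp pE.
pose Q j := \sum_(z <- rs) z ^+ j *: (P %/ ('X - z%:P)).
have Pz z : z \in rs -> ('X - z%:P) %| P by rewrite dvdp_XsubCl root_prod_XsubC.
have coefQ j : (Q j)`_(size rs).-1 = \sum_(z <- rs) z ^+ j.
  rewrite coef_sum; apply: eq_big_seq => z zrs; rewrite coefZ.
  have := divpK (Pz z zrs) => PK.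
  have szq : size (P %/ ('X - z%:P)) = size rs.
    by rewrite size_divp ?polyXsubC_eq0 // size_prod_XsubC size_XsubC subn1.
  have monq : P %/ ('X - z%:P) \is monic.
    by rewrite -(monicMr _ (monicXsubC z)) PK monic_prod_XsubC.
  by move: monq; rewrite monicE lead_coefE szq => /eqP ->; rewrite mulr1.
have QS j : Q j.+1 = 'X * Q j - (\sum_(z <- rs) z ^+ j) *: P.
  rewrite mulr_sumr scaler_suml -sumrB; apply: eq_big_seq => z zrs.
  rewrite -{3}(divpK (Pz z zrs)) exprS -!mul_polyC polyCM.
  by ring.
have intQ j : exists q : {poly int}, Q j = map_poly intr q.
  elim: j => [|j [q IH]].
    exists p^`(); rewrite -deriv_map pE /P deriv_prod_XsubC; apply: eq_bigr => z _.
    by rewrite expr0 scale1r.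
  exists ('X * q - q`_(size rs).-1 *: p).
  rewrite QS -coefQ IH rmorphB rmorphM /= map_polyX map_polyZ pE.
  by rewrite coef_map.
move=> j; have [q qE] := intQ j; exists q`_(size rs).-1.
by rewrite -coefQ qE coef_map.
Qed.


(** The [j]-th powers of all complex roots of the minimal polynomial sum to an integer. Setting
    apart the [m] copies of [a] leaves at most [size rs] terms, each of modulus at most [r ^+ j]. *)
Lemma pisot_near_integers (R : realType) (a : R) : is_pisot a ->
  exists (m : nat) (C r : R), [/\ (0 < m)%N, 0 <= C, 0 <= r < 1
    & forall j, exists N : int, `|m%:R * a ^+ j - N%:~R| <= C * r ^+ j].
Proof.
move=> [_ /algebraic_integer_minpoly[p [monp irrp pa]] conja].
have pE (L : numFieldType) :
    map_poly ratr (map_poly intr p : {poly rat}) = map_poly intr p :> {poly L}.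
  by rewrite -map_poly_comp; apply: eq_map_poly => z /=; rewrite ratr_int.
pose pC : {poly R[i]} := map_poly intr p.
have pCE : pC = map_poly (real_complex R) (map_poly intr p).
  by rewrite -map_poly_comp; apply: eq_map_poly => z /=; rewrite rmorph_int.
have [rs] := closed_field_poly_normal pC.
rewrite (monicP (monic_map _ monp)) scale1r => pCrs.
pose b : R[i] := (a%:C)%C.
have conj_lt1 z : z \in rs -> z != b -> `|z| < 1.
  move=> zrs /eqP zb; apply: conja => //; exists (map_poly intr p); split=> //.
  - by rewrite pE.
  - by rewrite pE -/pC pCrs root_prod_XsubC.
have brs : b \in rs.
  by rewrite -root_prod_XsubC -pCrs pCE fmorph_root.
(* [r] is the largest modulus of a root other than [b], or 0 if there is none. *)
have [r [r0 r1 rP]] : exists r : R, [/\ 0 <= r, r < 1 &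
    forall z, z \in rs -> z != b -> `|z| <= (r%:C)%C].
  elim: {brs pCrs}rs conj_lt1 => [|z s IH] zlt1.
    by exists 0; rewrite lexx ltr01.
  have [y ys|r [r0 r1 rP]] := IH; first by apply: zlt1; rewrite inE ys orbT.
  have [zb|zb] := eqVneq z b.
    exists r; split=> // y; rewrite inE => /predU1P[->|]; last exact: rP.
    by rewrite zb eqxx.
  have /= := zlt1 z (mem_head _ _) zb.
  rewrite normc_def -(rmorph1 (real_complex R)) ltcR => nz1.
  exists (Num.max r (Num.sqrt (complex.Re z ^+ 2 + complex.Im z ^+ 2))); split.
  - by rewrite le_max r0.
  - by rewrite gt_max r1.
  move=> y; rewrite inE => /predU1P[-> _|ys yb].
    by rewrite normc_def lecR le_max lexx orbT.
  by apply: le_trans (rP _ ys yb) _; rewrite lecR le_max lexx.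
exists (count_mem b rs), (size rs)%:R, r; split=> //.
- by rewrite -has_count has_pred1.
- by rewrite r0.
move=> j; have [N NE] := power_sum_int monp pCrs j; exists N.
have : (count_mem b rs)%:R * b ^+ j - N%:~R =
    - \sum_(z <- rs | z != b) z ^+ j.
  rewrite -NE (bigID (pred1 b)) /= opprD addrA [X in X + _](_ : _ = 0) ?add0r //.
  rewrite (eq_bigr (fun=> b ^+ j)) => [|z /eqP -> //].
  by rewrite big_const_seq iter_addr_0 mulr_natl subrr.
move/(congr1 Num.norm); rewrite normrN => sE.
rewrite -lecR.
suff -> : ((`|(count_mem b rs)%:R * a ^+ j - N%:~R|)%:C)%C =
    `|(count_mem b rs)%:R * b ^+ j - N%:~R|.
  rewrite {}sE; apply: le_trans (ler_norm_sum _ _ _) _.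
  apply: (@le_trans _ _ (\sum_(z <- rs | z != b) ((r ^+ j)%:C)%C)).
    rewrite big_seq_cond [leRHS]big_seq_cond.
    apply: ler_sum => z /andP[zrs zb].
    by rewrite normrX rmorphXn lerXn2r ?nnegrE ?rP // lecR.
  rewrite big_const_seq iter_addr_0 rmorphM rmorph_nat mulr_natl /=.
  by rewrite ler_wpMn2l ?count_size // lecR exprn_ge0.
rewrite (_ : _ - _ = (real_complex R) ((count_mem b rs)%:R * a ^+ j - N%:~R)).
  by rewrite normc_def /= expr0n /= addr0 sqrtr_sqr.
by rewrite rmorphB rmorphM rmorphXn rmorph_nat rmorph_int.
Qed.

End pisot_integers.

(** * Weak limits of bounded functions *)

Section weak_limits.
Context d (T : measurableType d) (R : realType).
Variable mu : {measure set T -> \bar R}.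

Lemma le1_integrable (D : set T) (f : T -> R) : measurable D ->
  (mu D < +oo)%E -> measurable_fun setT f -> (forall x, `|f x| <= 1) ->
  mu.-integrable D (EFin \o f).
Proof.
move=> mD Doo mf f1; apply: measurable_bounded_integrable => //.
  exact: measurable_funTS.
exists 1; split=> // M M1 x _ /=.
exact: le_trans (f1 x) (ltW M1).
Qed.

Lemma le1_normr_Rintegral (D : set T) (f : T -> R) : measurable D ->
  (mu D < +oo)%E -> measurable_fun setT f -> (forall x, `|f x| <= 1) ->
  `|\int[mu]_(x in D) f x| <= fine (mu D).
Proof.
move=> mD Doo mf f1.
apply: le_trans (le_normr_Rintegral mD (le1_integrable mD Doo mf f1)) _.
rewrite -[leRHS]mul1r -(Rintegral_cst _ mD).
apply: le_Rintegral => //.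
- apply: le1_integrable => //; first exact: measurableT_comp.
  by move=> x; rewrite normr_id.
- by apply: le1_integrable => // x; rewrite normr1.
Qed.

Import HBSimple.

Variable E : set T.
Hypotheses (mE : measurable E) (Eoo : (mu E < +oo)%E).
Variable h : nat -> T -> R.
Hypotheses (mh : forall k, measurable_fun setT (h k))
  (h1 : forall k x, `|h k x| <= 1).

Let EIoo A : measurable A -> (mu (E `&` A) < +oo)%E.
Proof.
move=> mA; apply: le_lt_trans Eoo.
by apply: le_measure; rewrite ?inE//; exact: measurableI.
Qed.

(** The sets [A] with this property form a Dynkin system. For a disjoint union, the tail has small
    measure inside [E], and [|h k| <= 1] makes its contribution small uniformly in [k]. *)
Lemma weak_limit_dynkin (G : set (set T)) :
  @measurable d T = <<s G >> -> setI_closed G ->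
  (fun k => \int[mu]_(x in E) h k x) @ \oo --> 0 ->
  (forall A, G A -> (fun k => \int[mu]_(x in E `&` A) h k x) @ \oo --> 0) ->
  forall A, measurable A ->
  (fun k => \int[mu]_(x in E `&` A) h k x) @ \oo --> 0.
Proof.
move=> sG GI hE hG; rewrite sG.
have splitU A B k : measurable A -> measurable B -> A `&` B = set0 ->
    \int[mu]_(x in E `&` (A `|` B)) h k x =
    \int[mu]_(x in E `&` A) h k x + \int[mu]_(x in E `&` B) h k x.
  move=> mA mB AB; rewrite setIUr Rintegral_setU //; do ?exact: measurableI.
    rewrite -setIUr; apply: le1_integrable => //.
      by apply: measurableI => //; exact: measurableU.
    by apply: EIoo; exact: measurableU.
  by apply/disj_setPS => x [[_ Ax] [_ Bx]]; rewrite -AB.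
apply: dynkin_induction sG GI _ hG _ _; first by rewrite setIT.
  move=> A mA hA; rewrite (_ : (fun _ => _) =
      (fun k => \int[mu]_(x in E) h k x - \int[mu]_(x in E `&` A) h k x)).
    by rewrite -[X in _ --> X](subr0 0); exact: cvgB.
  apply/funext => k; have := @splitU A (~` A) k mA (measurableC mA) (setICr A).
  by rewrite setUv setIT => ->; rewrite addrC addKr.
move=> F mF tF hF.
pose B n := \bigcup_(k in [set k | (n <= k)%N]) F k.
have mB n : measurable (B n) by apply: bigcup_measurable.
(* A point lies in at most one [F k], so the tails [B n] decrease to the empty set. *)
have EB0 : (fun n => mu (E `&` B n)) @ \oo --> 0%E.
  have -> : 0%E = mu (\bigcap_n (E `&` B n)).
    rewrite (_ : \bigcap_n _ = set0) ?measure0 //.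
    apply/seteqP; split=> // x EBx.
    have [_ [i /= _ Fix]] := EBx 0%N I.
    have [_ [j /= ij Fjx]] := EBx i.+1 I.
    have eij := tF i j I I (ex_intro _ x (conj Fix Fjx)).
    by rewrite -eij ltnn in ij.
  apply: nonincreasing_cvg_mu => //.
  - exact: EIoo.
  - by move=> n; exact: measurableI.
  - by apply: bigcap_measurable => [|n _]; [exists 0%N|exact: measurableI].
  - move=> n m nm; apply/subsetPset; apply: setIS => x [k /= mk Fkx].
    by exists k => //=; exact: leq_trans mk.
have Bsum k n : \int[mu]_(x in E `&` B 0%N) h k x =
    \sum_(i < n) \int[mu]_(x in E `&` F i) h k x +
    \int[mu]_(x in E `&` B n) h k x.
  elim: n => [|n ->]; first by rewrite big_ord0 add0r.
  rewrite big_ord_recr /= -addrA; congr (_ + _).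
  rewrite -splitU //.
    congr (Rintegral mu (E `&` _)); apply/seteqP; split=> x.
      move=> [k0 /=]; rewrite leq_eqVlt => /predU1P[<-|nk Fx]; [by left|].
      by right; exists k0.
    case=> [Fx|[k0 /= nk Fx]]; first by exists n => /=.
    by exists k0 => //=; exact: ltnW.
  apply/seteqP; split=> // x [Fnx [j /= nj Fjx]].
  have eij := tF n j I I (ex_intro _ x (conj Fnx Fjx)).
  by rewrite -eij ltnn in nj.
have -> : \bigcup_k F k = B 0%N by apply: eq_bigcupl; split=> i.
apply/cvgr0Pnorm_lt => e e0.
have e20 : 0 < e / 2 by rewrite divr_gt0.
have [n Bn] : exists n, (mu (E `&` B n) < (e / 2)%:E)%E.
  have /fine_cvg /cvgr0Pnorm_lt /(_ _ e20)[n _ /(_ n (leqnn n))] := EB0.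
  rewrite /= ger0_norm ?fine_ge0 // => nE; exists n.
  by rewrite -lte_fin fineK // in nE; rewrite ge0_fin_numE //; exact: EIoo.
have : (fun k => \sum_(i < n) \int[mu]_(x in E `&` F i) h k x) @ \oo --> 0.
  elim: n {Bn} => [|n IH].
    by under eq_fun do rewrite big_ord0; exact: cvg_cst.
  under eq_fun do rewrite big_ord_recr /=.
  by apply: cvg_trans (cvgD IH (hF n)) _; rewrite addr0.
move/cvgr0Pnorm_lt => /(_ _ e20); apply: filterS => k sk.
rewrite (Bsum k n) (le_lt_trans (ler_normD _ _)) // (splitr e) ltrD //.
apply: le_lt_trans (le1_normr_Rintegral _ _ (mh k) (h1 k)) _ => //.
- exact: measurableI.
- exact: EIoo.
by rewrite -lte_fin fineK // ge0_fin_numE //; exact: EIoo.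
Qed.

Lemma weak_limit_simple (g : {sfun T >-> R}) :
  (forall A, measurable A ->
    (fun k => \int[mu]_(x in E `&` A) h k x) @ \oo --> 0) ->
  (fun k => \int[mu]_(x in E) (h k x * g x)) @ \oo --> 0.
Proof.
move=> hA; pose s : seq R := finmap.enum_fset (fset_set (range g)).
pose A i := g @^-1` [set (s`_i)%R].
have mA i : measurable (A i) by exact: measurable_funPTI.
have int1 (n : nat) k (c : R) : mu.-integrable E
    (EFin \o (fun x => c * (h k x * \1_(A n) x))).
  have intA : mu.-integrable E (EFin \o (fun x => h k x * \1_(A n) x)).
    apply: le1_integrable => //; first by apply: measurable_funM.
    move=> x; rewrite normrM indicE.
    by case: (_ \in _); rewrite ?normr1 ?normr0 ?mulr1 ?mulr0 ?ler01.
  exact: (integrableZl mE c intA).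
have intsum k n : mu.-integrable E
    (EFin \o (fun x => \sum_(i < n) (s`_i * (h k x * \1_(A i) x)))).
  rewrite (_ : _ \o _ = fun x => (\sum_(i < n) (s`_i * (h k x * \1_(A i) x))%:E)%E).
    by apply: integrable_sum => // i _; exact: int1.
  by apply/funext => x /=; rewrite sumEFin.
have sumE k n : \int[mu]_(x in E) (\sum_(i < n) (s`_i * (h k x * \1_(A i) x))) =
    \sum_(i < n) (s`_i * \int[mu]_(x in E `&` A i) h k x).
  elim: n => [|n IH].
    under eq_Rintegral do rewrite big_ord0.
    by rewrite Rintegral_cst // mul0r big_ord0.
  under eq_Rintegral do rewrite big_ord_recr /=.
  rewrite RintegralD //; last exact: intsum.
  rewrite IH big_ord_recr /=; congr (_ + _).
  rewrite RintegralZl //; last first.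
    have := int1 n k 1.
    rewrite (_ : (fun x => 1 * _) = (fun x => h k x * \1_(A n) x)) //.
    by apply/funext => x; rewrite mul1r.
  rewrite Rintegral_mkcondr; congr (_ * Rintegral mu E _).
  apply/funext => x; rewrite indicE /patch.
  by case: (x \in A n); rewrite ?mulr1 ?mulr0.
under eq_fun => k.
  under eq_Rintegral => x _.
    rewrite fimfunEord mulr_sumr.
    under eq_bigr do rewrite mulrCA.
    over.
  rewrite sumE; over.
(* The limit is 0 for any number of terms, even past the end of [s], so the induction is on that
   number alone. *)
elim: (size (finmap.enum_fset _)) => [|n IH].
  by under eq_fun do rewrite big_ord0; exact: cvg_cst.
under eq_fun do rewrite big_ord_recr /=.
apply: cvg_trans (cvgD IH (cvgM (cvg_cst s`_n) (hA _ (mA n)))) _.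
by rewrite mulr0 addr0.
Qed.

(** Simple functions are dense in L1, and [|h k| <= 1] bounds the error of approximation uniformly
    in [k]. *)
Lemma weak_limit_integrable (f : T -> R) :
  (forall A, measurable A ->
    (fun k => \int[mu]_(x in E `&` A) h k x) @ \oo --> 0) ->
  mu.-integrable E (EFin \o f) ->
  (fun k => \int[mu]_(x in E) (h k x * f x)) @ \oo --> 0.
Proof.
move=> hA intf; have [g [intg _ gf]] := approximation_sfun_integrable mE intf.
apply/cvgr0Pnorm_lt => e e0.
have e20 : 0 < e / 2 by rewrite divr_gt0.
have hint (u : T -> R) k : mu.-integrable E (EFin \o u) ->
    mu.-integrable E (EFin \o (fun x => h k x * u x)).
  move=> intu; apply: (integrableMr mE _ _ intu) => //; first exact: measurable_funTS.
  by exists 1; split=> // M M1 x _; exact: le_trans (h1 k x) (ltW M1).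
have /fine_cvg /cvgr0Pnorm_lt /(_ _ e20)[n _ /(_ n (leqnn n)) fgn] := gf.
have := weak_limit_simple (g n) hA.
move/cvgr0Pnorm_lt => /(_ _ e20); apply: filterS => k gk.
have intfg : mu.-integrable E (EFin \o (fun x => f x - g n x)).
  exact: (integrableB mE intf (intg n)).
rewrite [X in Rintegral _ _ X](_ : _ =
  (fun x => h k x * (f x - g n x) + h k x * g n x)); last first.
  by apply/funext => x; ring.
rewrite RintegralD //; [|exact: hint..].
rewrite (le_lt_trans (ler_normD _ _)) // (splitr e) ltrD //.
apply: le_lt_trans fgn.
apply: le_trans (le_normr_Rintegral mE (hint _ _ intfg)) _.
apply: le_trans (ler_norm _).
apply: le_Rintegral => //.
- exact: integrable_norm (hint _ k intfg).
- exact: integrable_norm intfg.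
- by move=> x _; rewrite normrM ler_piMl.
Qed.

End weak_limits.

(** * The Riemann-Lebesgue lemma for dominated finite measures *)

Section riemann_lebesgue.
Variable R : realType.
Local Notation leb := (@lebesgue_measure R).

(** The antiderivative oscillates with amplitude 1 / xi, whatever the interval and the phase. *)
Lemma Rintegral_cos_affine_le (xi t a b : R) : 0 < xi -> a < b ->
  `|\int[leb]_(x in `[a, b]) cos (xi * x + t)| <= 2 / xi.
Proof.
move=> xi0 ab.
have xi_neq0 : xi != 0 by rewrite gt_eqF.
pose F (x : R) := sin (xi * x + t) / xi.
have dF (x : R) : is_derive x 1 F (cos (xi * x + t)).
  apply: is_derive_eq.
  by rewrite /GRing.scale /=; field.
have cF : continuous F.
  by move=> x; apply: differentiable_continuous; apply/derivable1_diffP.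
have cc : continuous (fun x : R => cos (xi * x + t)).
  move=> x; apply: differentiable_continuous; apply/derivable1_diffP.
  exact: ex_derive.
rewrite /Rintegral (@continuous_FTC2 _ _ F) //.
- rewrite -EFinB /= -mulrBl normrM normfV (gtr0_norm xi0).
  rewrite ler_pM2r ?invr_gt0 //.
  by rewrite (le_trans (ler_normB _ _)) // (_ : 2 = 1 + 1) // lerD // sin_max.
- exact: continuous_subspaceT.
- split.
  + by move=> x _; exact: ex_derive.
  + by apply: cvg_at_right_filter; exact: cF.
  + by apply: cvg_at_left_filter; exact: cF.
- by move=> x _; rewrite derive1E; exact: derive_val.
Qed.

(** Convergence on intervals extends to Borel subsets of a bounded interval, then to integration
    against the Radon-Nikodym density of [rho]. *)
Lemma dominated_weak_limit
    (rho : {finite_measure set (measurableTypeR R) -> \bar R})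
    (h : nat -> measurableTypeR R -> R) :
  (forall k, measurable_fun setT (h k)) -> (forall k x, `|h k x| <= 1) ->
  (forall a b, a < b -> (fun k => \int[leb]_(x in `[a, b]) h k x) @ \oo --> 0) ->
  rho `<< leb -> (fun k => \int[rho]_x h k x) @ \oo --> 0.
Proof.
move=> mh h1 hab rholeb.
(* Lebesgue measure is infinite, so limits are taken on bounded intervals, outside which [rho] has
   little mass. *)
pose E n : set (measurableTypeR R) := `[- (n.+1%:R), n.+1%:R]%classic.
have mE n : measurable (E n) by exact: measurable_itv.
have rhooo A : measurable A -> (rho A < +oo)%E.
  by move=> mA; rewrite ltey_eq fin_num_measure.
have lebE n : (leb (E n) < +oo)%E.
  by rewrite /E lebesgue_measure_itv /=; case: ifP => // _; rewrite -EFinD ltry.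
have tail : (fun n => rho (~` E n)) @ \oo --> 0%E.
  have -> : 0%E = rho (\bigcap_n ~` E n).
    rewrite (_ : \bigcap_n _ = set0) ?measure0 //.
    apply/seteqP; split=> // x /(_ (Num.truncn `|x|) I) /=; apply.
    rewrite /E /= in_itv /= -ler_norml; apply: ltW; exact: truncnS_gt.
  apply: nonincreasing_cvg_mu => //.
  - by apply: rhooo; exact: measurableC.
  - by move=> n; exact: measurableC.
  - by apply: bigcap_measurable => [|n _]; [exists 0%N|exact: measurableC].
  - move=> n m nm; apply/subsetPset; apply: subsetC => x /=.
    rewrite /E /= !in_itv /= -!ler_norml => /le_trans; apply.
    by rewrite ler_nat.
have intE n : (fun k => \int[leb]_(x in E n) h k x) @ \oo --> 0.
  by apply: hab; rewrite (@lt_trans _ _ 0) // ?oppr_lt0 ltr0n.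
have intEA n A : measurable A ->
    (fun k => \int[leb]_(x in E n `&` A) h k x) @ \oo --> 0.
  (* Closed half-lines generate the Borel sets, are stable under intersection, and meet [E n] in an
     interval, a point or the empty set. *)
  apply: (weak_limit_dynkin (mE n) (lebE n) mh h1 (RGenCInfty.measurableE R)) => //.
    move=> _ _ [x ->] [y ->]; exists (Num.max x y).
    apply/seteqP; split=> z /=; rewrite !in_itv /= !andbT ge_max.
      by move=> [-> ->].
    by move=> /andP[].
  move=> _ [x ->].
  rewrite /E (_ : _ `&` _ = `[Num.max (- n.+1%:R) x, n.+1%:R]%classic); last first.
    apply/seteqP; split=> z /=; rewrite !in_itv /= ?andbT ge_max.
      by move=> [/andP[-> ->] ->].
    by move=> /andP[/andP[-> ->] ->].
  have [mn|] := ltP (Num.max (- n.+1%:R) x) n.+1%:R; first exact: hab.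
  rewrite le_eqVlt => /predU1P[<-|nm].
    by rewrite set_itv1; under eq_fun do rewrite Rintegral_set1; exact: cvg_cst.
  rewrite set_itv_ge ?bnd_simp -?ltNge //.
  by under eq_fun do rewrite Rintegral_set0; exact: cvg_cst.
pose rn := Radon_Nikodym (charge_of_finite_measure rho) leb.
pose f x := fine (rn x).
have fE : EFin \o f = rn.
  apply/funext => x /=; rewrite fineK //; exact: Radon_Nikodym_fin_num.
have intf : leb.-integrable setT (EFin \o f).
  by rewrite fE; exact: Radon_Nikodym_integrable.
have rhof n k : \int[rho]_(x in E n) h k x = \int[leb]_(x in E n) (h k x * f x).
  rewrite /Rintegral; congr fine.
  rewrite -(Radon_Nikodym_change_of_variables rholeb) //; last first.
    by apply: le1_integrable => //; exact: rhooo.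
  by apply: eq_integral => x _; rewrite -/rn -fE.
apply/cvgr0Pnorm_lt => e e0.
have e20 : 0 < e / 2 by rewrite divr_gt0.
have /fine_cvg /cvgr0Pnorm_lt /(_ _ e20)[n _ /(_ n (leqnn n)) tn] := tail.
have := weak_limit_integrable (mE n) (lebE n) mh h1 (intEA n)
  (integrableS measurableT (mE n) (@subsetT _ _) intf).
move/cvgr0Pnorm_lt => /(_ _ e20); apply: filterS => k hk.
rewrite -(setUv (E n)) Rintegral_setU //; last 3 first.
- exact: measurableC.
- by rewrite setUv; apply: le1_integrable => //; exact: rhooo.
- by apply/disj_setPCl.
rewrite (le_lt_trans (ler_normD _ _)) // (splitr e) ltrD //; first by rewrite rhof.
apply: le_lt_trans tn; apply: le_trans (ler_norm _).
apply: le1_normr_Rintegral => //; first exact: measurableC.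
by apply: rhooo; exact: measurableC.
Qed.

End riemann_lebesgue.

(** * Self-similar measures on the line *)

(* The canonical measure on [pushforward m f] depends on a proof that [f] is
   measurable, which unification cannot find. *)
Definition pushforward_measure d1 d2 (T1 : measurableType d1)
    (T2 : measurableType d2) (R : realType) (m : {measure set T1 -> \bar R})
    (f : T1 -> T2) (mf : measurable_fun setT f) : {measure set T2 -> \bar R} :=
  measure_function_pushforward__canonical__measure_function_Measure m mf.

Section self_similar_integral.
Context d (T : measurableType d) (R : realType).
Variables (rho : {finite_measure set T -> \bar R}) (q p : R) (t0 t1 : T -> T).
Hypotheses (q0 : 0 <= q) (p0 : 0 <= p).
Hypotheses (mt0 : measurable_fun setT t0) (mt1 : measurable_fun setT t1).
Hypothesis rhoE : forall A, measurable A ->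
  (rho A = q%:E * rho (t0 @^-1` A) + p%:E * rho (t1 @^-1` A))%E.

Let rhooo A : measurable A -> (rho A < +oo)%E.
Proof. by move=> mA; rewrite ltey_eq fin_num_measure. Qed.

(** By [rhoE], [rho] is the sum of two scaled pushforwards of itself. *)
Lemma ge0_integral_self_similar (f : T -> \bar R) :
  measurable_fun setT f -> (forall x, 0 <= f x)%E ->
  (\int[rho]_x f x =
   q%:E * \int[rho]_x f (t0 x) + p%:E * \int[rho]_x f (t1 x))%E.
Proof.
move=> mf f0.
pose m0 := mscale (NngNum q0) (pushforward_measure rho mt0).
pose m1 := mscale (NngNum p0) (pushforward_measure rho mt1).
rewrite (eq_measure_integral (measure_add m0 m1)); last first.
  move=> A mA _; apply: etrans (rhoE mA) _; symmetry.
  exact: (measure_addE m0 m1 A).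
rewrite ge0_integral_measure_add // !ge0_integral_mscale //.
by rewrite !ge0_integral_pushforward // !preimage_setT.
Qed.

(** The nonnegative case applies to [1 + f]; the masses coming from the 1 cancel by self-similarity
    on the whole space. *)
Lemma Rintegral_self_similar (f : T -> R) :
  measurable_fun setT f -> (forall x, `|f x| <= 1) ->
  \int[rho]_x f x = q * \int[rho]_x f (t0 x) + p * \int[rho]_x f (t1 x).
Proof.
move=> mf f1.
have int1 (g : T -> R) : measurable_fun setT g -> (forall x, `|g x| <= 1) ->
    rho.-integrable setT (EFin \o g).
  by move=> mg g1; apply: le1_integrable => //; exact: rhooo.
have shift (g : T -> R) : measurable_fun setT g -> (forall x, `|g x| <= 1) ->
    (\int[rho]_x (1 + g x)%:E)%E = (fine (rho setT) + \int[rho]_x g x)%:E.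
  move=> mg g1.
  have i1 : rho.-integrable setT (EFin \o (fun=> 1 : R)).
    by apply: int1 => // x; rewrite normr1.
  rewrite -(mul1r (fine _)) -Rintegral_cst // -RintegralD //; last exact: int1.
  rewrite /Rintegral fineK //; apply: integrable_fin_num => //.
  exact: (integrableD measurableT i1 (int1 _ mg g1)).
have mf1 : measurable_fun setT (fun x => (1 + f x)%:E).
  by apply/measurable_EFinP; apply: measurable_funD.
have pos x : (0 <= (1 + f x)%:E)%E.
  by rewrite lee_fin -lerBlDl sub0r; have := f1 x; rewrite ler_norml => /andP[].
have := ge0_integral_self_similar mf1 pos.
rewrite !shift //; last 2 first.
- exact: measurableT_comp.
- exact: measurableT_comp.
have rhoT : fine (rho setT) = (q + p) * fine (rho setT).
  apply/EFin_inj; rewrite EFinM EFinD fineK ?fin_num_measure // ge0_muleDl //.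
  by rewrite {1}rhoE // !preimage_setT.
rewrite -!EFinM -EFinD => /(congr1 fine) /=.
by move: rhoT; set F := fine _; lra.
Qed.

End self_similar_integral.

(** * Two facts about the cosine *)

Section trigo.
Variable R : realType.

Lemma one_sub_cos_le (x : R) : 1 - cos x <= `|x|.
Proof.
rewrite -cos_norm; have [->|x0] := eqVneq `|x| 0; first by rewrite cos0 subrr.
have x_gt0 : 0 < `|x| by rewrite lt_def x0 normr_ge0.
have [c _] : exists2 c, c \in `]0, `|x|[%R & cos `|x| - cos 0 = - sin c * (`|x| - 0).
  apply: MVT => //.
  by apply: continuous_subspaceT; exact: continuous_cos.
rewrite cos0 subr0 => /eqP; rewrite subr_eq => /eqP ->.
rewrite opprD addrCA subrr addr0 mulNr opprK -[leRHS]mul1r.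
by rewrite ler_pM2r // sin_le1.
Qed.

Lemma cos_sub_int2pi (x : R) (N : int) : cos (x - 2 * pi * N%:~R) = cos x.
Proof.
suff nat_case (y : R) (n : nat) : cos (y - 2 * pi * n%:R) = cos y.
  case: N => n; first exact: nat_case.
  by rewrite NegzE mulrNz mulrN opprK -(nat_case _ n.+1) addrK.
have := periodicn (@cosD2pi R) n (y - 2 * pi * n%:R) => <-; congr cos.
by rewrite -[_ *+ n]mulr_natr -[pi *+ 2]mulr_natr; ring.
Qed.

End trigo.

(** * The Fourier transform of a self-similar measure *)

Section fourier.
Variable R : realType.
Local Notation leb := (@lebesgue_measure R).
Variables (al q p : R).
Hypotheses (al1 : 1 < al) (p0 : 0 <= p) (pq : p < q) (qp1 : q + p = 1).
Variable rho : {finite_measure set (measurableTypeR R) -> \bar R}.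
Let t0 (x : measurableTypeR R) : measurableTypeR R := al^-1 * x.
Let t1 (x : measurableTypeR R) : measurableTypeR R := al^-1 * (x + 1).
Hypothesis rhoE : forall A, measurable A ->
  (rho A = q%:E * rho (t0 @^-1` A) + p%:E * rho (t1 @^-1` A))%E.

Let al0 : 0 < al. Proof. exact: lt_trans al1. Qed.

Let q0 : 0 <= q. Proof. exact: ltW (le_lt_trans p0 pq). Qed.

Let rhooo A : measurable A -> (rho A < +oo)%E.
Proof. by move=> mA; rewrite ltey_eq fin_num_measure. Qed.

Let mlin (a b : R) : measurable_fun setT (fun x : measurableTypeR R => a * x + b).
Proof. by apply: measurable_funD => //; exact: mulrl_measurable. Qed.

Let mcos (a b : R) :
  measurable_fun setT (fun x : measurableTypeR R => cos (a * x + b)).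
Proof.
apply: measurableT_comp (mlin a b); apply: continuous_measurable_fun.
exact: continuous_cos.
Qed.

Let msin (a b : R) :
  measurable_fun setT (fun x : measurableTypeR R => sin (a * x + b)).
Proof.
apply: measurableT_comp (mlin a b); apply: continuous_measurable_fun.
exact: continuous_sin.
Qed.

(** Real and imaginary parts of the Fourier transform with kernel exp(i xi x); [sqr_transform] is
    its squared modulus. *)
Definition cos_transform (xi : R) := \int[rho]_x cos (xi * x).
Definition sin_transform (xi : R) := \int[rho]_x sin (xi * x).
Definition sqr_transform xi := cos_transform xi ^+ 2 + sin_transform xi ^+ 2.

Let mcos0 a : measurable_fun setT (fun x : measurableTypeR R => cos (a * x)).
Proof.
rewrite (_ : (fun _ => _) = fun x => cos (a * x + 0))//.
by apply/funext => x; rewrite addr0.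
Qed.

Let msin0 a : measurable_fun setT (fun x : measurableTypeR R => sin (a * x)).
Proof.
rewrite (_ : (fun _ => _) = fun x => sin (a * x + 0))//.
by apply/funext => x; rewrite addr0.
Qed.

Let icos a : rho.-integrable setT (EFin \o (fun x => cos (a * x))).
Proof. by apply: le1_integrable => //; [exact: rhooo|move=> x; exact: cos_max]. Qed.

Let isin a : rho.-integrable setT (EFin \o (fun x => sin (a * x))).
Proof. by apply: le1_integrable => //; [exact: rhooo|move=> x; exact: sin_max]. Qed.

Let mt0 : measurable_fun setT t0.
Proof. exact: mulrl_measurable. Qed.

Let mt1 : measurable_fun setT t1.
Proof.
by apply: measurableT_comp; [exact: mulrl_measurable|exact: measurable_funD].
Qed.

(** Real part of rho^(al xi) = (q + p exp(i xi)) rho^(xi); [sin_transform_scale] is the imaginary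
    part. *)
Lemma cos_transform_scale xi : cos_transform (al * xi) =
  q * cos_transform xi +
  p * (cos xi * cos_transform xi - sin xi * sin_transform xi).
Proof.
rewrite /cos_transform (Rintegral_self_similar q0 p0 mt0 mt1 rhoE) //; last first.
  by move=> x; exact: cos_max.
congr (_ * _ + _ * _).
  by apply: eq_Rintegral => x _; rewrite /t0 mulrACA mulfV ?gt_eqF // mul1r.
have icosZ := integrableZl measurableT (cos xi) (icos xi).
have isinZ := integrableZl measurableT (sin xi) (isin xi).
rewrite -!RintegralZl // -RintegralB //.
apply: eq_Rintegral => x _.
by rewrite /t1 mulrACA mulfV ?gt_eqF // mul1r mulrDr mulr1 cosD mulrC [sin _ * _]mulrC.
Qed.

Lemma sin_transform_scale xi : sin_transform (al * xi) =
  q * sin_transform xi +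
  p * (cos xi * sin_transform xi + sin xi * cos_transform xi).
Proof.
rewrite /sin_transform (Rintegral_self_similar q0 p0 mt0 mt1 rhoE) //; last first.
  by move=> x; exact: sin_max.
congr (_ * _ + _ * _).
  by apply: eq_Rintegral => x _; rewrite /t0 mulrACA mulfV ?gt_eqF // mul1r.
have icosZ := integrableZl measurableT (sin xi) (icos xi).
have isinZ := integrableZl measurableT (cos xi) (isin xi).
rewrite -!RintegralZl // -RintegralD //.
apply: eq_Rintegral => x _.
rewrite /t1 mulrACA mulfV ?gt_eqF // mul1r mulrDr mulr1 sinD.
by rewrite mulrC [cos _ * sin _]mulrC.
Qed.

(** The factor is |q + p exp(i xi)|^2, rewritten with q + p = 1. *)
Lemma sqr_transform_scale xi :
  sqr_transform (al * xi) = (1 - 2 * p * q * (1 - cos xi)) * sqr_transform xi.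
Proof.
rewrite /sqr_transform cos_transform_scale sin_transform_scale.
set c := cos_transform xi; set s := sin_transform xi.
have -> : (1 : R) = (q + p) ^+ 2 by rewrite qp1 expr1n.
transitivity ((q ^+ 2 + p ^+ 2 * (cos xi ^+ 2 + sin xi ^+ 2) + 2 * p * q * cos xi) *
  (c ^+ 2 + s ^+ 2)); first by ring.
rewrite cos2Dsin2 qp1; have -> : q = 1 - p by rewrite -qp1 addrK.
by ring.
Qed.

Lemma sqr_transform_ge0 xi : 0 <= sqr_transform xi.
Proof. by rewrite addr_ge0 ?sqr_ge0. Qed.

(** The scaling factor equals (q - p)^2 + 2 p q (1 + cos xi), which is positive as p < q. *)
Lemma sqr_transform_eq0_scale xi :
  sqr_transform (al * xi) = 0 -> sqr_transform xi = 0.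
Proof.
rewrite sqr_transform_scale => /eqP; rewrite mulf_eq0 => /orP[/eqP e|/eqP//].
have := cos_geN1 xi; have := cos_le1 xi; exfalso.
have qE : q = 1 - p by rewrite -qp1 addrK.
have p2 : 0 < 1 - 2 * p by move: pq; rewrite qE; lra.
have : 0 < (1 - 2 * p) ^+ 2 by rewrite exprn_gt0.
have : 0 <= p * (1 - p) * (1 + cos xi).
  by rewrite !mulr_ge0 //; have := cos_geN1 xi; move: p2 p0; lra.
by move: e; rewrite qE; nra.
Qed.

(** By dominated convergence. It recovers the total mass from the transform along frequencies
    tending to 0. *)
Lemma cos_transform_cvg (xi : nat -> R) : xi @ \oo --> 0 ->
  cos_transform (xi k) @[k --> \oo] --> fine (rho setT).
Proof.
move=> xi0.
have mc k : measurable_fun setT (EFin \o (fun x : measurableTypeR R => cos (xi k * x))).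
  exact/measurable_EFinP.
have i1 : rho.-integrable setT (EFin \o (fun=> 1 : R)).
  by apply: le1_integrable => //; [exact: rhooo|move=> x; rewrite normr1].
have [] := @dominated_convergence _ _ _ rho setT measurableT
  (fun k x => (cos (xi k * x))%:E) (fun=> 1%:E) (fun=> 1%:E) mc _ _ i1 _.
- exact: measurable_cst.
- apply: aeW => x _; apply/fine_cvgP; split; first by near=> n.
  rewrite -(@cos0 R); apply: continuous_cvg; first exact: continuous_cos.
  by rewrite -(mul0r x); apply: cvgM => //; exact: cvg_cst.
- by apply: aeW => x k _; rewrite /= lee_fin; exact: cos_max.
rewrite integral_cst // mul1e => _ _ cvgT.
have : (\int[rho]_x (cos (xi k * x))%:E)%E @[k --> \oo] --> (fine (rho setT))%:E.
  by rewrite fineK // fin_num_measure.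
exact: fine_cvg.
Unshelve. all: by end_near.
Qed.

Lemma sqr_transform_cvg (xi : nat -> R) :
  (forall k, 0 < xi k) -> xi @ \oo --> +oo ->
  rho `<< leb -> sqr_transform (xi k) @[k --> \oo] --> 0.
Proof.
move=> xi0 xioo rholeb.
(* The phase [t] lets one limit serve both transforms, the sine being a cosine shifted by pi / 2. *)
have cvg0 (t : R) : \int[rho]_x cos (xi k * x + t) @[k --> \oo] --> 0.
  apply: (dominated_weak_limit (h := fun k x => cos (xi k * x + t))) => //.
    by move=> k x; exact: cos_max.
  move=> a b ab; apply/cvgr0Pnorm_lt => e e0.
  near=> k; apply: le_lt_trans (Rintegral_cos_affine_le _ (xi0 k) ab) _.
  rewrite ltr_pdivrMr // mulrC -ltr_pdivrMr //.
  near: k; exact: cvgry_gt.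
have c0 : cos_transform (xi k) @[k --> \oo] --> 0.
  rewrite /cos_transform
    (_ : (fun k => _) = (fun k => \int[rho]_x cos (xi k * x + 0))) //.
  by apply/funext => k; under [RHS]eq_Rintegral do rewrite addr0.
have s0 : sin_transform (xi k) @[k --> \oo] --> 0.
  rewrite /sin_transform
    (_ : (fun k => _) = (fun k => \int[rho]_x cos (xi k * x + - (pi / 2)))) //.
  by apply/funext => k; under [RHS]eq_Rintegral do rewrite cosBpihalf.
apply: cvg_trans (cvgD (cvgM c0 c0) (cvgM s0 s0)) _.
by rewrite mulr0 addr0.
Unshelve. all: by end_near.
Qed.

End fourier.

(** * Vanishing of dominated self-similar measures *)

Section pisot_self_similar.
Variable R : realType.
Local Notation leb := (@lebesgue_measure R).

(** From some index [J] on, the deviations of the factors from 1 sum to at most 1/2, so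
    [G (e (J + k))] stays above half of [G (e J)] while tending to 0. The resulting zero is carried
    down to frequencies tending to 0. *)
Lemma pisot_self_similar_dominated_eq0 (al q p : R)
    (rho : {finite_measure set (measurableTypeR R) -> \bar R}) :
  is_pisot al -> 0 <= p -> p < q -> q + p = 1 ->
  (forall A : set (measurableTypeR R), measurable A ->
    (rho A =
     q%:E * rho ((fun x : measurableTypeR R => (al^-1 * x)%R) @^-1` A) +
     p%:E * rho ((fun x : measurableTypeR R => (al^-1 * (x + 1))%R) @^-1` A))%E) ->
  rho `<< leb -> rho setT = 0%E.
Proof.
move=> pisal p0 pq qp1 rhoE rholeb.
have al1 : 1 < al by case: pisal.
have al0 : 0 < al by exact: lt_trans al1.
have [m [C [r [m0 C0 /andP[r0 r1] near_int]]]] := pisot_near_integers pisal.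
pose e j : R := 2 * pi * (m%:R * al ^+ j).
pose G := sqr_transform rho.
have alV1 : `|al^-1| < 1 by rewrite gtr0_norm ?invr_gt0 // invf_lt1.
have mR : 0 < m%:R :> R by rewrite ltr0n.
have e_gt0 j : 0 < e j by rewrite !mulr_gt0 // ?pi_gt0 // exprn_gt0.
have eS j : e j.+1 = al * e j by rewrite /e exprS; ring.
pose K := 2 * pi * C.
have K0 : 0 <= K by rewrite !mulr_ge0 // pi_ge0.
have qE : q = 1 - p by rewrite -qp1 addrK.
have pq2 : 0 <= 2 * p * q <= 1.
  by rewrite qE; move: pq p0; rewrite qE => ? ?; apply/andP; split; nra.
(* [e j] is within 2 pi C r^j of a multiple of 2 pi, and 1 - cos is bounded by that distance. *)
have aK j : 0 <= 2 * p * q * (1 - cos (e j)) <= K * r ^+ j.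
  have c0 : 0 <= 1 - cos (e j) by rewrite subr_ge0 cos_le1.
  case/andP: pq2 => pq20 pq21; rewrite mulr_ge0 //=.
  apply: (@le_trans _ _ (1 - cos (e j))); first by rewrite ler_piMl.
  have [N NP] := near_int j.
  rewrite -(cos_sub_int2pi _ N); apply: le_trans (one_sub_cos_le _) _.
  rewrite -mulrBr normrM ger0_norm ?mulr_ge0 ?pi_ge0 // /K -mulrA.
  by rewrite ler_wpM2l // mulr_ge0 // pi_ge0.
(* The left side is the sum of the bounds [K * r ^+ j] over all [j >= J]. *)
have [J KJ] : exists J, K * r ^+ J / (1 - r) <= 1 / 2.
  have rJ : (fun J => K * r ^+ J / (1 - r)) @ \oo --> 0.
    rewrite -(mul0r (1 - r)^-1) -(mulr0 K); apply: cvgM; last exact: cvg_cst.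
    apply: cvgM; first exact: cvg_cst.
    by apply: cvg_expr; rewrite ger0_norm.
  have h2 : 0 < 1 / 2 :> R by lra.
  have /cvgr0Pnorm_lt /(_ _ h2)[J _ /(_ J (leqnn J)) JP] := rJ.
  by exists J; apply: ltW; exact: le_lt_trans (ler_norm _) JP.
pose K' := K * r ^+ J / (1 - r).
have K'0 : 0 <= K' by rewrite divr_ge0 ?subr_ge0 ?(ltW r1) // mulr_ge0 // exprn_ge0.
(* Telescoping form: the bounds from index [J] to [J + k - 1] sum to [K' * (1 - r ^+ k)]. *)
have K'E k : K * r ^+ (J + k) = K' * (r ^+ k - r ^+ k.+1).
  by rewrite exprD exprS /K'; field; rewrite subr_eq0 gt_eqF.
have rk k : 0 <= r ^+ k <= 1 by rewrite exprn_ge0 // exprn_ile1 // ltW.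
(* A product of factors 1 - a_i with each a_i in [0, 1] is at least 1 minus the sum of the a_i. *)
have Gge k : (1 - K' * (1 - r ^+ k)) * G (e J) <= G (e (J + k)%N).
  elim: k => [|k IH]; first by rewrite addn0 expr0 subrr mulr0 subr0 mul1r.
  rewrite addnS eS /G (sqr_transform_scale al1 p0 pq qp1 rhoE) -/G.
  have := aK (J + k)%N; rewrite K'E; set a := 2 * p * q * _ => /andP[a0 aK'].
  have G0 : 0 <= G (e J) by exact: sqr_transform_ge0.
  have /andP[rk0 rk1] := rk k; have /andP[rk0' rk1'] := rk k.+1.
  have a1 : 0 <= 1 - a by move: KJ; rewrite -/K'; nra.
  apply: le_trans (ler_wpM2l a1 IH); rewrite mulrA ler_wpM2r //.
  have : 0 <= a * (K' * (1 - r ^+ k)).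
    by apply: mulr_ge0 => //; apply: mulr_ge0 => //; rewrite subr_ge0.
  by lra.
have Ghalf k : G (e J) / 2 <= G (e (J + k)%N).
  apply: le_trans (Gge k); rewrite mulrC ler_wpM2r //; first exact: sqr_transform_ge0.
  by have /andP[rk0 rk1] := rk k; move: KJ K'0; rewrite -/K'; nra.
have GJ0 : G (e J) = 0.
  apply/eqP; rewrite eq_le sqr_transform_ge0 andbT.
  suff : G (e J) / 2 <= 0 by rewrite pmulr_lle0.
  have eoo : (fun k => e (J + k)%N) @ \oo --> +oo.
    apply/gtr0_cvgV0; first by apply: nearW => k; exact: e_gt0.
    have : (fun k => (e J)^-1 * (al^-1) ^+ k) @ \oo --> (e J)^-1 * 0.
      by apply: cvgM; [exact: cvg_cst|exact: cvg_expr].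
    rewrite mulr0; apply: cvg_trans; apply: near_eq_cvg; apply: nearW => k /=.
    by rewrite exprVn -invfM /e exprD; congr (_^-1); ring.
  have Gcvg := sqr_transform_cvg (fun k => e_gt0 (J + k)%N) eoo rholeb.
  rewrite -(cvg_lim _ Gcvg) //; apply: limr_ge; first by apply/cvg_ex; exists 0.
  by apply: nearW => k; exact: Ghalf.
(* The scaling factor never vanishes, so the zero passes to each frequency divided by [al]. *)
have GJi i : G (e J * al^-1 ^+ i) = 0.
  elim: i => [|i IH]; first by rewrite expr0 mulr1.
  apply: (sqr_transform_eq0_scale al1 p0 pq qp1 rhoE); rewrite -IH; congr G.
  by rewrite exprS mulrCA mulVKf // gt_eqF.
have Ci i : cos_transform rho (e J * al^-1 ^+ i) = 0.
  apply/eqP; rewrite -sqrf_eq0; have /eqP := GJi i.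
  by rewrite paddr_eq0 ?sqr_ge0 // => /andP[].
have xi0 : (fun i => e J * al^-1 ^+ i) @ \oo --> 0.
  rewrite -(mulr0 (e J)); apply: cvgM; first exact: cvg_cst.
  exact: cvg_expr.
have := @cos_transform_cvg _ rho _ xi0.
rewrite (_ : (fun k => _) = (fun=> 0)); last by apply/funext.
move=> /(cvg_unique _ (cvg_cst 0)) T0.
by rewrite -(fineK (fin_num_measure rho _ measurableT)) -T0.
Qed.

End pisot_self_similar.

(** * Lebesgue decomposition by a maximal null set *)

Section maximal_null_set.
Context d (T : measurableType d) (R : realType).
Variables (leb : {measure set T -> \bar R})
  (nu : {finite_measure set T -> \bar R}).

(** Take the union of a sequence of null sets whose [nu]-masses approach the supremum. *)
Lemma maximal_null_set : exists N, [/\ measurable N, leb N = 0%E &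
  forall A, measurable A -> leb A = 0%E -> (nu A <= nu N)%E].
Proof.
pose S := [set nu A | A in [set A | measurable A /\ leb A = 0%E]].
have S0 : S != set0 by apply/set0P; exists (nu set0); exists set0.
have [u uS ucvg] := ereal_sup_seq S0.
pose F i := sval (cid2 (uS i)).
have FP i : [/\ measurable (F i), leb (F i) = 0%E & nu (F i) = u i].
  by rewrite /F; case: cid2 => A /= [].
have mF i : measurable (F i) by case: (FP i).
have mU : measurable (\bigcup_i F i) by exact: bigcupT_measurable.
exists (\bigcup_i F i); split=> //.
  apply: measure_negligible => //; apply: negligible_bigcup => i.
  by apply/negligibleP => //; case: (FP i).
move=> A mA A0; apply: (@le_trans _ _ (ereal_sup S)).
  by apply: ereal_sup_ubound; exists A.
rewrite -(cvg_lim _ ucvg) //; apply: lime_le.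
  by apply/cvg_ex; exists (ereal_sup S).
apply: nearW => i; case: (FP i) => _ _ <-.
by apply: le_measure; rewrite ?inE //; exact: bigcup_sup.
Qed.

Variables (q p : R) (t0 t1 : T -> T).
Hypotheses (q0 : 0 < q) (p0 : 0 < p) (qp1 : q + p = 1).
Hypotheses (mt0 : measurable_fun setT t0) (mt1 : measurable_fun setT t1).
Hypotheses (null_t0 : forall A, measurable A -> leb A = 0%E -> leb (t0 @^-1` A) = 0%E)
  (null_t1 : forall A, measurable A -> leb A = 0%E -> leb (t1 @^-1` A) = 0%E).
Hypothesis nuE : forall A, measurable A ->
  (nu A = q%:E * nu (t0 @^-1` A) + p%:E * nu (t1 @^-1` A))%E.

(* Self-similarity forces the preimages of a maximal null set N under t0 and
   t1 to have the same nu-measure as N, hence to agree with N up to nu-null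
   sets: the part of nu off N inherits the self-similarity. *)
Lemma self_similar_lebesgue_decomposition :
  exists (N : set T) (rho : {finite_measure set T -> \bar R}),
  [/\ measurable N, leb N = 0%E,
      forall A, measurable A -> rho A = nu (A `\` N),
      rho `<< leb &
      forall A, measurable A ->
      (rho A = q%:E * rho (t0 @^-1` A) + p%:E * rho (t1 @^-1` A))%E].
Proof.
have [N [mN N0 Nmax]] := maximal_null_set.
have pre (t : T -> T) : measurable_fun setT t ->
    forall A, measurable A -> measurable (t @^-1` A).
  by move=> mt A mA; rewrite -[X in measurable X]setTI; exact: mt.
have nuoo A : measurable A -> nu A \is a fin_num by move=> mA; exact: fin_num_measure.
have splitD A B : measurable A -> measurable B ->
    nu A = (nu (A `\` B) + nu (A `&` B))%E by exact: measureDI.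
(* Otherwise adding [A] to [N] would give a null set of larger mass. *)
have off A : measurable A -> leb A = 0%E -> nu (A `\` N) = 0%E.
  move=> mA A0; have mAN : measurable (A `\` N) by exact: measurableD.
  have UN : (nu (N `|` (A `\` N)) <= nu N)%E.
    apply: Nmax; first exact: measurableU.
    apply: measure_negligible; first exact: measurableU.
    apply: negligibleU; first exact/negligibleP.
    by apply: negligibleS (@subDsetl _ A N) _; exact/negligibleP.
  move: UN; rewrite measureU //; last by apply/seteqP; split=> // x [? []].
  move=> UN.
  apply/eqP; rewrite -measure_le0.
  by rewrite -(@leeD2lE _ (nu N)) ?adde0 // nuoo.
have same M : measurable M -> leb M = 0%E -> nu M = nu N ->
    forall A, measurable A -> nu (A `\` M) = nu (A `\` N).
  move=> mM M0 MN A mA.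
  have NM0 : nu (N `\` M) = 0%E.
    have := splitD _ _ mM mN; rewrite (off _ mM M0) add0e MN => NI.
    have := splitD _ _ mN mM; rewrite setIC -NI => NE.
    by rewrite -[LHS](addeK _ (nuoo _ mN)) -NE subee // nuoo.
  have mAN : measurable (A `\` N) by exact: measurableD.
  have mAM : measurable (A `\` M) by exact: measurableD.
  rewrite (splitD _ _ mAM mN) (splitD _ _ mAN mM).
  rewrite setDDl setUC -setDDl; congr (_ + _)%E.
  transitivity (0 : \bar R)%E; last symmetry; apply/eqP; rewrite -measure_le0.
    rewrite -NM0; apply: le_measure; rewrite ?inE; do ?exact: measurableI;
      do ?exact: measurableD.
    by move=> x [[_ Mx] Nx].
  rewrite -(off M) //; apply: le_measure; rewrite ?inE; do ?exact: measurableI;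
    do ?exact: measurableD.
  by move=> x [[_ Nx] Mx].
have mCN : measurable (~` N) by exact: measurableC.
pose rho : {finite_measure set T -> \bar R} := mrestr nu mCN.
have rhoE A : rho A = nu (A `\` N) by [].
have t0le := Nmax _ (pre _ mt0 _ mN) (null_t0 mN N0).
have t1le := Nmax _ (pre _ mt1 _ mN) (null_t1 mN N0).
(* Two numbers at most [nu N] whose mean with positive weights is [nu N] must both equal it. *)
have [t0N t1N] : nu (t0 @^-1` N) = nu N /\ nu (t1 @^-1` N) = nu N.
  have := nuE mN; move: t0le t1le.
  rewrite -(fineK (nuoo _ mN)) -(fineK (nuoo _ (pre _ mt0 _ mN))).
  rewrite -(fineK (nuoo _ (pre _ mt1 _ mN))) -!EFinM -EFinD !lee_fin => a b [e].
  move: a b e; set y := fine _; set x := fine (nu N); set z := fine _ => a b e.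
  have qpx : q * x + p * x = x by rewrite -mulrDl qp1 mul1r.
  have : q * (x - y) + p * (x - z) = 0 by rewrite !mulrBr; lra.
  move/eqP; rewrite paddr_eq0 ?mulr_ge0 ?subr_ge0 ?(ltW q0) ?(ltW p0) //.
  rewrite !mulf_eq0 (gt_eqF q0) (gt_eqF p0) /= !subr_eq0.
  by move=> /andP[/eqP -> /eqP ->].
exists N, rho; split=> //.
- by apply/null_content_dominatesP => A mA A0; rewrite rhoE off.
- move=> A mA; rewrite !rhoE nuE; last exact: measurableD.
  congr (_ * _ + _ * _)%E.
    exact: (same _ (pre _ mt0 _ mN) (null_t0 mN N0) t0N _ (pre _ mt0 _ mA)).
  exact: (same _ (pre _ mt1 _ mN) (null_t1 mN N0) t1N _ (pre _ mt1 _ mA)).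
Qed.

End maximal_null_set.

(** * Lebesgue measure under affine maps *)

Section lebesgue_affine.
Variable R : realType.
Local Notation leb := (@lebesgue_measure R).

(** Both sides are measures agreeing on half-open intervals, which determine Lebesgue measure. *)
Lemma lebesgue_measure_affine (c t : R) (A : set (measurableTypeR R)) :
  0 < c -> measurable A ->
  (leb A = c%:E * leb ((fun x : measurableTypeR R => (c * x + t)%R) @^-1` A))%E.
Proof.
move=> c0 mA; pose f (x : measurableTypeR R) : measurableTypeR R := c * x + t.
have mf : measurable_fun setT f.
  by apply: measurable_funD => //; exact: mulrl_measurable.
apply: (lebesgue_measure_unique
  (mu := mscale (NngNum (ltW c0)) (pushforward_measure leb mf))) => //.
move=> _ [[a b] _ <-]; rewrite /= /mscale /= /pushforward.
rewrite (_ : f @^-1` _ = `](a - t) / c, (b - t) / c]%classic); last first.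
  apply/seteqP; split=> x /=; rewrite !in_itv /= /f.
    move=> /andP[ax xb]; rewrite ltr_pdivrMr // ler_pdivlMr // mulrC.
    by rewrite ltrBlDr lerBrDr ax.
  by rewrite ltr_pdivrMr // ler_pdivlMr // mulrC ltrBlDr lerBrDr.
rewrite !lebesgue_measure_itv /= !lte_fin ltr_pM2r ?invr_gt0 // ltrD2r.
case: ifP => // _; last by rewrite mule0.
by rewrite -!EFinB -EFinM; congr EFin; field; rewrite gt_eqF.
Qed.

Lemma lebesgue_measure_affine_null (c t : R) (A : set (measurableTypeR R)) :
  0 < c -> measurable A -> leb A = 0%E ->
  leb ((fun x : measurableTypeR R => (c * x + t)%R) @^-1` A) = 0%E.
Proof.
move=> c0 mA; rewrite (lebesgue_measure_affine t c0 mA) => /eqP.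
by rewrite mule_eq0 eqe gt_eqF //= => /eqP.
Qed.

End lebesgue_affine.

(** * Singularity and absence of atoms on the line *)

Section self_similar_line.
Variable R : realType.
Local Notation leb := (@lebesgue_measure R).
Variables (al q p : R).
Hypotheses (al1 : 1 < al) (q0 : 0 < q) (p0 : 0 < p) (qp1 : q + p = 1).
Variable nu : {finite_measure set (measurableTypeR R) -> \bar R}.
Let t0 (x : measurableTypeR R) : measurableTypeR R := al^-1 * x.
Let t1 (x : measurableTypeR R) : measurableTypeR R := al^-1 * (x + 1).
Hypothesis nuE : forall A, measurable A ->
  (nu A = q%:E * nu (t0 @^-1` A) + p%:E * nu (t1 @^-1` A))%E.

Let al0 : 0 < al. Proof. exact: lt_trans al1. Qed.

(** The part of [nu] off a maximal null set is dominated and self-similar, hence zero. *)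
Lemma pisot_self_similar_singular : is_pisot al -> p < q ->
  exists N, [/\ measurable N, leb N = 0%E & nu (~` N) = 0%E].
Proof.
move=> pisal pq.
have mt0 : measurable_fun setT t0 by exact: mulrl_measurable.
have mt1 : measurable_fun setT t1.
  by apply: measurableT_comp; [exact: mulrl_measurable|exact: measurable_funD].
have alV0 : 0 < al^-1 by rewrite invr_gt0.
have [A mA A0|A mA A0|N [rho [mN N0 rhoNE rholeb rhoE]]] :=
    self_similar_lebesgue_decomposition (leb := leb) q0 p0 qp1 mt0 mt1 _ _ nuE.
- rewrite (_ : t0 = fun x => (al^-1 * x + 0)%R); last first.
    by apply/funext => x; rewrite addr0.
  exact: lebesgue_measure_affine_null.
- rewrite (_ : t1 = fun x => (al^-1 * x + al^-1)%R); last first.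
    by apply/funext => x; rewrite /t1 mulrDr mulr1.
  exact: lebesgue_measure_affine_null.
exists N; split=> //.
rewrite -setTD -rhoNE //.
exact: (pisot_self_similar_dominated_eq0 pisal (ltW p0) pq qp1 rhoE rholeb).
Qed.

(* Near-maximal point masses are preserved by x |-> al x, so a positive
   supremum of the point masses would put almost that mass on arbitrarily many
   points al^j x; the second map is only used to move away from the fixed
   point 0. *)
Lemma self_similar_atomless (x : R) : nu [set x] = 0%E.
Proof.
have m1 (y : R) : measurable ([set y] : set (measurableTypeR R)).
  exact: measurable_set1.
pose f (y : R) := fine (nu [set y]).
have fE y : nu [set y] = (f y)%:E by rewrite fineK // fin_num_measure.
have f_ge0 y : 0 <= f y by rewrite fine_ge0.
have fS y : f y = q * f (al * y) + p * f (al * y - 1).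
  apply/EFin_inj; rewrite -fE EFinD !EFinM -!fE nuE //.
  congr (_ * nu _ + _ * nu _)%E; apply/seteqP; split=> z /=; rewrite /t0 /t1.
  - by move=> <-; rewrite mulVKf // gt_eqF.
  - by move=> ->; rewrite mulKf // gt_eqF.
  - by move=> <-; rewrite mulVKf ?gt_eqF // addrK.
  - by move=> ->; rewrite subrK mulKf // gt_eqF.
pose F := fine (nu setT).
have fF y : f y <= F.
  by rewrite fine_le ?fin_num_measure // le_measure ?inE.
have Sb : has_sup (range f).
  by split; [exists (f 0); exists 0|exists F => _ [y _ <-]].
pose s := sup (range f).
have fs y : f y <= s by apply: ub_le_sup; [case: Sb|exists y].
have [s0|s_gt0] := leP s 0.
  by rewrite fE; congr EFin; apply/eqP; rewrite eq_le f_ge0 (le_trans (fs x)).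
exfalso.
have q1 : q <= 1 by rewrite -qp1 lerDl ltW.
have p1 : p <= 1 by rewrite -qp1 lerDr ltW.
(* So many disjoint sets of mass at least [s / 2] outweigh the total mass [F]. *)
pose k := (Num.truncn (F / (s / 2))).+1.
have kF : F < k%:R * (s / 2) by rewrite -ltr_pdivrMr ?divr_gt0 // truncnS_gt.
(* Each later step divides the gap to [s] by [q], so this gap is still below [s / 2] after [k]
   steps. If the near-maximal point is 0, [fS] at 0 leads to -1 at the price of a factor [p], hence
   the choice of [e0]. *)
have [y y0 fy] : exists2 y, y != 0 & s - q ^+ k * (s / 2) < f y.
  have c0 : 0 < q ^+ k * (s / 2) by rewrite mulr_gt0 ?exprn_gt0 ?divr_gt0.
  have e0 : 0 < p * (q ^+ k * (s / 2)) by rewrite mulr_gt0.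
  have [_ [z _ <-] fz] := sup_adherent e0 Sb; rewrite -/s in fz.
  have [z0|z0] := eqVneq z 0; last first.
    exists z => //; apply: le_lt_trans fz; rewrite lerD2l lerN2.
    by rewrite ler_piMl // ltW.
  exists (-1); first by rewrite oppr_eq0 oner_eq0.
  have := fS z; rewrite z0 mulr0 sub0r => f0; rewrite z0 in fz.
  have fs0 : q * f 0 <= q * s by rewrite ler_wpM2l // ltW.
  rewrite -(ltr_pM2l p0) mulrBr.
  have sE : q * s + p * s = s by rewrite -mulrDl qp1 mul1r.
  by move: fz f0 fs0 sE; set c := p * (_ * _); lra.
(* In [fS] the value at [al * y - 1] is at most [s], so the value at [al * y] has at most the gap
   divided by [q]. *)
have fj j i : (i + j)%N = k -> s - q ^+ i * (s / 2) < f (al ^+ j * y).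
  elim: j i => [|j IH] i; first by rewrite addn0 expr0 mul1r => ->.
  rewrite addnS -addSn => /IH; rewrite exprS -(mulrA q) fS.
  rewrite [al ^+ j.+1]exprS -(mulrA al); set z := al * _ => h.
  have ps : p * f (z - 1) <= p * s by rewrite ler_wpM2l // ltW.
  have sE : q * s + p * s = s by rewrite -mulrDl qp1 mul1r.
  rewrite -(ltr_pM2l q0) mulrBr.
  by move: h ps sE; set c := q * (_ * _); lra.
have fj2 j : (j <= k)%N -> s / 2 <= f (al ^+ j * y).
  move=> jk; apply: ltW; apply: le_lt_trans (fj j (k - j)%N _); last by rewrite subnK.
  have : q ^+ (k - j) * (s / 2) <= s / 2.
    have s2 : 0 <= s / 2 by rewrite divr_ge0 // ltW.
    by rewrite ler_piMl // exprn_ile1 // ltW.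
  by lra.
pose A j : set (measurableTypeR R) := [set al ^+ j * y].
have tA : trivIset setT A.
  apply/trivIsetP => i j _ _ ij; apply/seteqP; split=> // z [/= -> /(mulIf y0)].
  by move/(ieexprIn al0 (negbT (gt_eqF al1))) => e; rewrite e eqxx in ij.
have mA j : measurable (A j) by exact: m1.
have sumF : (\sum_(j < k) nu (A j) <= F%:E)%E.
  rewrite -(measure_bigsetU nu mA tA) fineK ?fin_num_measure //.
  by rewrite le_measure ?inE //; exact: bigsetU_measurable.
have : k%:R * (s / 2) <= F.
  rewrite -lee_fin; apply: le_trans sumF.
  under eq_bigr do rewrite fE.
  rewrite sumEFin lee_fin mulr_natl -[X in _ *+ X]card_ord -sumr_const.
  by apply: ler_sum => j _; apply: fj2; exact: ltnW.
by rewrite leNgt kF.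
Qed.

End self_similar_line.

(** * Projection to a coordinate *)

Section projection.
Variables (R : realType) (n : nat) (i0 : 'I_n).
Local Notation leb := (@lebesgue_measure R).

Let coord (x : 'rV[R]_n) : measurableTypeR R := x 0 i0.

(** The cylinder is a box with one null side; the infinite sides do no harm since 0 * oo = 0. *)
Lemma lebesgue_rV_cylinder_null (N : set (measurableTypeR R)) :
  measurable N -> leb N = 0%E -> lebesgue_rV R n (coord @^-1` N) = 0%E.
Proof.
move=> mN N0; pose A i := if i == i0 then N else [set: measurableTypeR R].
have mA i : measurable (A i) by rewrite /A; case: ifP.
rewrite (_ : coord @^-1` N = [set x | forall i, A i (x 0 i)]).
  by rewrite lebesgue_rV_box // (bigD1 i0) //= /A eqxx N0 mul0e.
apply/seteqP; split=> x /=; last by move=> /(_ i0); rewrite /A eqxx.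
by move=> Nx i; rewrite /A; case: eqP => // ->.
Qed.

Lemma measurable_rV_set1 (x : 'rV[R]_n) : measurable [set x].
Proof.
rewrite (_ : [set x] =
  \bigcap_(i in [set: 'I_n]) ((fun y : 'rV[R]_n => y 0 i) @^-1` [set x 0 i])).
  apply: fin_bigcap_measurable => // i _.
  by rewrite -[X in measurable X]setTI; apply: measurable_rV_coord => //;
    exact: measurable_set1.
apply/seteqP; split=> y /=; first by move=> -> i _.
by move=> yx; apply/rowP => i; exact: yx.
Qed.

(** Only the digit [delta_mx 0 i0] shifts this coordinate; the other [n] digits, 0 included, act on
    it as multiplication by [lambda]. *)
Lemma hutchinson_coord (lambda : R) (mu : probability 'rV[R]_n R)
    (B : set (measurableTypeR R)) : is_hutchinson lambda mu -> measurable B ->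
  (mu (coord @^-1` B) =
   (n%:R / n.+1%:R)%:E * mu (coord @^-1` ((fun x => (lambda * x)%R) @^-1` B)) +
   (n.+1%:R^-1)%:E * mu (coord @^-1` ((fun x => (lambda * (x + 1))%R) @^-1` B)))%E.
Proof.
move=> hmu mB.
have mC C : measurable C -> measurable (coord @^-1` C).
  by move=> mC; rewrite -[X in measurable X]setTI; exact: measurable_rV_coord.
rewrite hmu; last exact: mC.
rewrite /simplex_digits big_cons big_map big_enum /= (bigD1 i0) //=.
set X := mu (coord @^-1` (_ @^-1` B)); set Y := mu (coord @^-1` (_ @^-1` B)).
have -> : mu (ifs_map lambda 0 @^-1` (coord @^-1` B)) = X.
  by congr (mu _); apply/seteqP; split=> x /=; rewrite /coord /ifs_map !mxE addr0.
have -> : mu (ifs_map lambda (delta_mx 0 i0) @^-1` (coord @^-1` B)) = Y.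
  by congr (mu _); apply/seteqP; split=> x /=; rewrite /coord /ifs_map !mxE !eqxx.
rewrite (eq_bigr (fun=> X)); last first.
  move=> i ii0; congr (mu _); apply/seteqP; split=> x /=;
    by rewrite /coord /ifs_map !mxE eqxx eq_sym (negbTE ii0) addr0.
have muT C : measurable C -> mu C \is a fin_num by exact: fin_num_measure.
have mlin (f : measurableTypeR R -> measurableTypeR R) :
    measurable_fun setT f -> mu (coord @^-1` (f @^-1` B)) \is a fin_num.
  move=> mf; apply: muT; apply: mC.
  by rewrite -[X in measurable X]setTI; exact: mf.
have Xfin : X \is a fin_num by apply: mlin; exact: mulrl_measurable.
have Yfin : Y \is a fin_num.
  apply: mlin; apply: measurableT_comp; first exact: mulrl_measurable.
  exact: measurable_funD.
rewrite -(fineK Xfin) -(fineK Yfin) sumEFin sumr_const cardC1 card_ord.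
have n0 : (0 < n)%N by exact: leq_ltn_trans (ltn_ord i0).
apply: (congr1 EFin (_ : n.+1%:R^-1 * (fine X + (fine Y + fine X *+ n.-1)) =
  n%:R / n.+1%:R * fine X + n.+1%:R^-1 * fine Y)).
rewrite addrCA -mulrS prednK // -mulr_natl; ring.
Qed.

End projection.

(** * Return from the first coordinate to the space *)

Theorem corollary5p2 (R : realType) (d : nat) (hd : (2 < d)%N)
  (alpha : R) (halpha : is_pisot alpha)
  (mu : probability 'rV[R]_d R) (hmu : is_hutchinson alpha^-1 mu) :
  ~ (mu `<< lebesgue_rV R d) /\
  purely_singular_continuous (lebesgue_rV R d) mu.
Proof.
pose i0 : 'I_d := Ordinal (ltn_trans (isT : (0 < 2)%N) hd).
pose coord (x : 'rV[R]_d) : measurableTypeR R := x 0 i0.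
have mcoord : measurable_fun setT coord := measurable_rV_coord i0.
have mpre C : measurable C -> measurable (coord @^-1` C).
  by move=> mC; rewrite -[X in measurable X]setTI; exact: mcoord.
have al1 : 1 < alpha by case: halpha.
pose push := pushforward_measure mu mcoord.
have pushT : (push setT < +oo)%E by exact: (fin_num_fun_lty (fin_num_measure mu)).
(* Restricting to the whole line gives the pushforward the structure of a finite measure. *)
pose nu : {finite_measure set (measurableTypeR R) -> \bar R} :=
  mfrestr measurableT pushT.
have nuE B : nu B = mu (coord @^-1` B) by rewrite /nu /= /mfrestr /mrestr setIT.
have d0 : 0 < d%:R :> R by rewrite ltr0n (ltn_trans _ hd).
have d1 : 0 < d.+1%:R :> R by rewrite ltr0n.
have q0 : 0 < d%:R / d.+1%:R :> R by rewrite divr_gt0.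
have p0 : 0 < d.+1%:R^-1 :> R by rewrite invr_gt0.
have qp1 : d%:R / d.+1%:R + d.+1%:R^-1 = 1 :> R.
  by rewrite -[X in _ + X]mul1r -mulrDl natr1 mulfV // gt_eqF.
have pq : d.+1%:R^-1 < d%:R / d.+1%:R :> R.
  by rewrite -[ltLHS]mul1r ltr_pM2r // ltr1n (ltn_trans _ hd).
have self B : measurable B ->
    (nu B = (d%:R / d.+1%:R)%:E * nu ((fun x => (alpha^-1 * x)%R) @^-1` B) +
      (d.+1%:R^-1)%:E * nu ((fun x => (alpha^-1 * (x + 1))%R) @^-1` B))%E.
  by move=> mB; rewrite !nuE; exact: hutchinson_coord.
have [N [mN N0 nuN]] := pisot_self_similar_singular al1 q0 p0 qp1
  (nu := nu) self halpha pq.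
have atomless := self_similar_atomless al1 q0 p0 qp1 (nu := nu) self.
(* This null cylinder carries all of [mu]. *)
pose M := coord @^-1` N.
have mM : measurable M by exact: mpre.
have M0 : lebesgue_rV R d M = 0%E by exact: lebesgue_rV_cylinder_null.
have muM : mu (~` M) = 0%E by rewrite -nuN nuE.
split.
  move=> /null_content_dominatesP /(_ _ mM M0) muM0.
  have := measureU mu mM (measurableC mM) (setICr M).
  rewrite setUv [LHS]probability_setT [X in (X + _)%E]muM0 [X in (_ + X)%E]muM.
  by rewrite adde0 => /eqP; rewrite eqe oner_eq0.
split.
(* The decomposition is 0 plus [mu], with [mu] singular through [M]. *)
- exists mzero, mu; split.
  + by apply/null_content_dominatesP => A mA _.
  + by exists M.
  + by move=> A mA; rewrite /= /mzero add0e.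
(* [ac] vanishes on the null set [M], and off [M] it is at most [mu], which is 0 there. *)
- move=> ac [sg [/null_content_dominatesP aclac _ musum]] A mA.
  apply/eqP; rewrite -measure_le0.
  have mAM : measurable (A `&` M) by exact: measurableI.
  have mAD : measurable (A `\` M) by exact: measurableD.
  rewrite (measureDI ac mA mM).
  rewrite [X in (_ + X)%E](_ : _ = 0%E) ?adde0; last first.
    by apply: aclac => //; exact: subset_measure0 M0.
  apply: (@le_trans _ _ (mu (A `\` M))).
    by rewrite musum // leeDl.
  rewrite -muM; apply: le_measure; rewrite ?inE.
  + exact: mAD.
  + exact: measurableC.
  + by move=> x [].
(* A point lies in the hyperplane fixing its first coordinate, whose mass is that of a point for
   [nu], hence 0. *)
- move=> A mA; apply: esum1 => x _.
  apply/eqP; rewrite -measure_le0 -(atomless (coord x)) nuE.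
  apply: le_measure; rewrite ?inE; first exact: measurable_rV_set1.
    by apply: mpre; exact: measurable_set1.
  by move=> y /= ->.
Qed.
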